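(* Let $(X,d)$ be a complete $\mathrm{CAT}(1)$-space and let $\phi:X\to(-\infty,\infty]$ be a lower semi-continuous function with $D(\phi)\neq\emptyset$ that is $\lambda$-convex for some $\lambda\in\mathbb{R}$ and coercive with constant $\tau_*(\phi)\in(0,\infty]$. Let $x\in D(\phi)$ and $\tau\in\big(0,\min\{\pi^2/(2C),\tau_*(\phi)/8\}\big)$, where $C=C(x,\tau_*(\phi),\phi(x),\tau_*(\phi)/8)>0$ is the a priori constant described in the context. Take $x_\tau\in J^\phi_\tau(x)$. Then, for any $R<\pi$, any $y\in D(\phi)\cap B(x_\tau,R-d(x,x_\tau))$, and for $K=K(R)$ as in the context, $$d^2(x_\tau,y)\le d^2(x,y)-\lambda\tau d^2(x_\tau,y)+2\tau\{\phi(y)-\phi(x_\tau)\}-\frac{K}{2}d^2(x,x_\tau)$$ and $$d^2(x,y)-\lambda\tau d^2(x_\tau,y)+2\tau\{\phi(y)-\phi(x_\tau)\}-\frac{K}{2}d^2(x,x_\tau)\le d^2(x,y)-\lambda\tau d^2(x_\tau,y)+2\tau\{\phi(y)-\phi(x_\tau)\}+\max\{0,-K\}\cdot\tau\{\phi(x)-\phi(x_\tau)\}.$$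
   Context: $B(z,r)$ is the open ball of radius $r$ about $z$; $D(\phi):=X\setminus\phi^{-1}(\infty)$. A minimal geodesic is a curve $\gamma:[0,1]\to X$ with $d(\gamma(s),\gamma(t))=|s-t|\,d(\gamma(0),\gamma(1))$. $(X,d)$ is geodesic if any two points are joined by a minimal geodesic. A geodesic metric space is a $\mathrm{CAT}(1)$-space if for any $x,y,z\in X$ with $d(x,y)+d(y,z)+d(z,x)<2\pi$ and any minimal geodesic $\gamma$ from $y$ to $z$, $d(x,\gamma(t))\le d_{\mathbb{S}^2}(\tilde x,\tilde\gamma(t))$ for all $t\in[0,1]$, where $\tilde x,\tilde y,\tilde z\in\mathbb{S}^2$ (unit sphere) form a comparison triangle with the same side lengths and $\tilde\gamma$ is the minimal geodesic from $\tilde y$ to $\tilde z$. $\phi$ is $\lambda$-convex if for any $x,y\in D(\phi)$, $\phi(\gamma(t))\le(1-t)\phi(x)+t\phi(y)-\frac{\lambda}{2}(1-t)t\,d^2(x,y)$ for all $t\in[0,1]$ along some minimal geodesic $\gamma:[0,1]\to X$ from $x$ to $y$ (hence along the unique minimal geodesic when $d(x,y)<\pi$). For $\tau>0$, $\phi_\tau(x):=\inf_{z\in X}\{\phi(z)+\frac{d^2(x,z)}{2\tau}\}$ and $J^\phi_\tau(x):=\{z\in X:\phi(z)+\frac{d^2(x,z)}{2\tau}=\phi_\tau(x)\}$. Coercivity: $\tau_*(\phi)\in(0,\infty]$ is such that $\phi_\tau(x)>-\infty$ and $J^\phi_\tau(x)\neq\emptyset$ for all $x\in X$, $\tau\in(0,\tau_*(\phi))$.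 The constant $K(R)$, $R\in(0,\pi)$: a real number such that for every $z\in X$ the function $d^2(z,\cdot)$ is $K(R)$-convex on $B(z,R)$, i.e. $d^2(z,\gamma(t))\le(1-t)d^2(z,\gamma(0))+t\,d^2(z,\gamma(1))-\frac{K(R)}{2}(1-t)t\,d^2(\gamma(0),\gamma(1))$ for every minimal geodesic $\gamma$ contained in $B(z,R)$ and $t\in[0,1]$. Such a constant exists for every $\mathrm{CAT}(1)$-space. The constant $C(x_*,\tau_*(\phi),Q,T)$: a positive constant such that, whenever $0=t^0<t^1<\cdots$ with $t^k\to\infty$, $\tau_k:=t^k-t^{k-1}$, $\sup_k\tau_k\le\tau_*(\phi)/8$, $t^N\le T$, and $(x^k)_{k\ge0}$ satisfies $x^k\in J^\phi_{\tau_k}(x^{k-1})$ for $k\ge1$ with $\phi(x^0)\le Q$ and $d^2(x^0,x_* )\le Q$, one has for all $1\le k\le N$: $d^2(x^k,x_* )\le C$ and $\sum_{l=1}^k\frac{d^2(x^{l-1},x^l)}{2\tau_l}\le\phi(x^0)-\phi(x^k)\le C$. In the claim it is used with $x_*=x$, $Q=\phi(x)$, $T=\tau_*(\phi)/8$. *)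

(* Defs.v *)
From mathcomp Require Import all_boot all_order all_algebra.
From mathcomp Require Import all_classical all_reals all_analysis.

Set Implicit Arguments.
Unset Strict Implicit.
Unset Printing Implicit Defensive.

Import Order.TTheory GRing.Theory Num.Theory.

Local Open Scope classical_set_scope.
Local Open Scope ring_scope.

(* The axiom of completeType, without its choice of a distinguished point. *)
Definition complete_space (X : uniformType) : Prop :=
  forall F : set_system X, ProperFilter F -> cauchy F -> exists l : X, F --> l.

(* A curve [0,1] -> T is represented by a function R -> T, of which only the
   restriction to [0,1] is ever constrained or used. *)
Definition minimal_geodesic (R : realType) (T : Type) (d : T -> T -> R)
    (g : R -> T) : Prop :=
  {in `[0, 1] &, forall s t, d (g s) (g t) = `|s - t| * d (g 0) (g 1)}.

Definition minimal_geodesic_between (R : realType) (T : Type)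
    (d : T -> T -> R) (x y : T) (g : R -> T) : Prop :=
  [/\ minimal_geodesic d g, g 0 = x & g 1 = y].

Definition dot3 (R : realType) (u v : 'rV[R]_3) : R := (u *m v^T) 0 0.

Definition sphere2 (R : realType) : Type := {u : 'rV[R]_3 | dot3 u u == 1}.

Definition sphere2_dist (R : realType) (u v : sphere2 R) : R :=
  acos (dot3 (val u) (val v)).

Definition geodesic_space (R : realType) (X : metricType R) : Prop :=
  forall x y : X, exists g, minimal_geodesic_between mdist x y g.

Definition CAT1 (R : realType) (X : metricType R) : Prop :=
  geodesic_space X /\
  forall (x y z : X) (g : R -> X) (x' y' z' : sphere2 R) (g' : R -> sphere2 R),
    mdist x y + mdist y z + mdist z x < 2 * pi ->
    minimal_geodesic_between mdist y z g ->
    sphere2_dist x' y' = mdist x y ->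
    sphere2_dist y' z' = mdist y z ->
    sphere2_dist z' x' = mdist z x ->
    minimal_geodesic_between (@sphere2_dist R) y' z' g' ->
    {in `[0, 1], forall t, mdist x (g t) <= sphere2_dist x' (g' t)}.

Section Functionals.
Context {R : realType} {X : metricType R}.
Implicit Types (phi : X -> \bar R) (x z : X).

Definition effective_domain phi : set X := ~` (phi @^-1` [set +oo%E]).

Definition lambda_convex (lambda : R) phi : Prop :=
  forall x y, effective_domain phi x -> effective_domain phi y ->
  exists2 g, minimal_geodesic_between mdist x y g &
  {in `[0, 1], forall t,
    (phi (g t) <= (1 - t)%:E * phi x + t%:E * phi y
                  - (lambda / 2 * (1 - t) * t * mdist x y ^+ 2)%:E)%E}.

Definition moreau phi (tau : R) x : \bar R :=
  ereal_inf [set (phi z + (mdist x z ^+ 2 / (2 * tau))%:E)%E | z in [set: X]].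

Definition resolvent phi (tau : R) x : set X :=
  [set z | (phi z + (mdist x z ^+ 2 / (2 * tau))%:E)%E = moreau phi tau x].

Definition coercive phi (tau_star : \bar R) : Prop :=
  (0 < tau_star)%E /\
  forall x (tau : R), 0 < tau -> (tau%:E < tau_star)%E ->
    (-oo < moreau phi tau x)%E /\ resolvent phi tau x !=set0.

Definition discrete_solution phi (t : nat -> R) (xs : nat -> X) : Prop :=
  forall k, resolvent phi (t k.+1 - t k) (xs k) (xs k.+1).

Definition apriori_constant phi (xstar : X) (tau_star Q T : \bar R) (C : R)
    : Prop :=
  0 < C /\
  forall (t : nat -> R) (xs : nat -> X) (N : nat),
    t 0%N = 0 -> (forall k, t k < t k.+1) -> t @ \oo --> +oo ->
    (ereal_sup (range (fun k => (t k.+1 - t k)%:E)) <= tau_star * 8^-1%:E)%E ->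
    ((t N)%:E <= T)%E ->
    discrete_solution phi t xs ->
    (phi (xs 0%N) <= Q)%E -> ((mdist (xs 0%N) xstar ^+ 2)%:E <= Q)%E ->
    forall k, (1 <= k <= N)%N ->
      [/\ mdist (xs k) xstar ^+ 2 <= C,
          ((\sum_(1 <= l < k.+1)
              mdist (xs l.-1) (xs l) ^+ 2 / (2 * (t l - t l.-1)))%:E
            <= phi (xs 0%N) - phi (xs k))%E &
          (phi (xs 0%N) - phi (xs k) <= C%:E)%E].

End Functionals.

Definition sqdist_convexity_constant (R : realType) (X : metricType R)
    (r K : R) : Prop :=
  forall (z : X) (g : R -> X),
    minimal_geodesic mdist g ->
    {in `[0, 1], forall t, ball z r (g t)} ->
    {in `[0, 1], forall t,
      mdist z (g t) ^+ 2 <= (1 - t) * mdist z (g 0) ^+ 2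
                            + t * mdist z (g 1) ^+ 2
                            - K / 2 * (1 - t) * t * mdist (g 0) (g 1) ^+ 2}.

(* Main.v *)
(** First variation argument. Write p = x_tau. Since p minimizes
    [phi + d^2(x, .) / (2 tau)], convexity of phi along the geodesic g from p to y
    bounds the derivative of [d^2(x, g t)] at [t = 0] from below. In a CAT(1)-space
    that derivative is at most [- 2 d(p, x) d(p, y) cos alpha], alpha being the angle
    at p, hence at most the derivative of [d^2(y, h s)] at [s = 0], where h is a geodesic
    from p to x; the latter is bounded above by K-convexity of [d^2(y, .)] along h.
    This exchange of x and y is why the K-term carries [d^2(x, x_tau)]. *)
Require Import Defs.
From mathcomp Require Import all_boot all_order all_algebra.
From mathcomp Require Import all_classical all_reals all_analysis.
From mathcomp Require Import ring lra.

Set Implicit Arguments.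
Unset Strict Implicit.

Import Order.TTheory GRing.Theory Num.Theory.
Import numFieldNormedType.Exports.

Local Open Scope classical_set_scope.
Local Open Scope ring_scope.

(** * One-sided first-order conditions and the derivative of the hinge function *)

Lemma is_derive_right_ge0 (R : realType) (f : R -> R) (df : R) :
  is_derive (0 : R) 1 f df -> f 0 = 0 -> (\forall t \near 0^'+, 0 <= f t) -> 0 <= df.
Proof.
move=> fdf f0 f_ge0; have [fd <-] := fdf.
have cvf : (h^-1 *: ((f \o shift 0) (h *: (1 : R)) - f 0)) @[h --> 0^'+] --> 'D_1 f 0.
  exact: cvg_dnbhs_at_right.
rewrite -(cvg_lim _ cvf)//; apply: limr_ge; first by apply/cvg_ex; eexists; exact: cvf.
near=> t; rewrite /= f0 subr0 addr0 [t *: 1]mulr1.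
by apply: mulr_ge0; [rewrite invr_ge0; near: t; exact: nbhs_right_ge | near: t].
Unshelve. all: by end_near. Qed.

Lemma affine_perturbation_ge0 (R : realType) (e m : R) :
  (forall t, 0 < t <= 1 -> 0 <= t * e + t ^+ 2 * m) -> 0 <= e.
Proof.
move=> H; rewrite leNgt; apply/negP => e0.
have m1 : 0 < `|m| + 1 by rewrite ltr_wpDl.
have mm := ler_norm m.
(* If [e < 0], this choice gives [t * m <= - e / 2], hence [e + t * m < 0]; the minimum with 1 keeps
   [t] admissible. *)
pose t := Num.min 1 (- e / (2 * (`|m| + 1))).
have t0 : 0 < t by rewrite lt_min ltr01 divr_gt0 ?oppr_gt0// mulr_gt0.
have t1 : t <= 1 by rewrite ge_min lexx.
have te : t * (2 * (`|m| + 1)) <= - e by rewrite -ler_pdivlMr ?mulr_gt0// ge_min lexx orbT.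
have /H : 0 < t <= 1 by rewrite t0.
rewrite expr2 -mulrA -mulrDr pmulr_rge0// => ?; nra.
Qed.

(** By the spherical law of cosines, the [acos] term is the side opposite to the angle of cosine [c]
    in a hinge with sides [w] and [t * b]; its slope at 0 is [- b * c]. The bounds on [w] keep
    [cos w] inside ]-1, 1[, where [acos] is differentiable. The length [l] allows for a broken
    path. *)
Lemma is_derive_spherical_hinge_sqr (R : realType) (w l b c : R) : 0 < w < pi ->
  is_derive (0 : R) 1
    (fun t => (l + acos (cos w * cos (t * b) + sin w * sin (t * b) * c)) ^+ 2)
    (- (2 * (l + w) * b * c)).
Proof.
move=> wpi; have sw := sin_gt0_pi wpi.
have /andP[w0 wp] := wpi.
pose F := fun t : R => cos w * cos (t * b) + sin w * sin (t * b) * c.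
have F0 : F 0 = cos w by rewrite /F mul0r cos0 sin0; ring.
have dlin : is_derive (0 : R) 1 (fun t : R => t * b) b.
  have H : is_derive (0 : R) 1 ((id : R -> R) * cst b) b.
    by apply: is_derive_eq; rewrite scaler0 add0r [_ *: _]mulr1.
  exact: H.
have dF : is_derive (0 : R) 1 F (sin w * b * c).
  have dc : is_derive (0 : R) 1 (cos \o (fun t : R => t * b)) 0.
    have := @is_derive1_comp R cos (fun t => t * b) 0 _ _ (is_derive_cos _) dlin.
    by rewrite mul0r sin0 oppr0 mul0r.
  have ds : is_derive (0 : R) 1 (sin \o (fun t : R => t * b)) b.
    have := @is_derive1_comp R sin (fun t => t * b) 0 _ _ (is_derive_sin _) dlin.
    by rewrite mul0r cos0 mul1r.
  have H : is_derive (0 : R) 1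
      (cos w *: (cos \o (fun t : R => t * b))
       + (sin w * c) *: (sin \o (fun t : R => t * b))) (sin w * b * c).
    have := is_deriveD (is_deriveZ (cos w) dc) (is_deriveZ (sin w * c) ds).
    by rewrite scaler0 add0r [_ *: _]mulrAC.
  suff -> : F = cos w *: (cos \o (fun t : R => t * b))
       + (sin w * c) *: (sin \o (fun t : R => t * b)) by [].
  by apply/funext => t; rewrite /F !fctE /= /GRing.scale /=; ring.
have cw : -1 < cos w < 1.
  rewrite -cospi -[X in _ < _ < X](@cos0 R).
  by rewrite !ltr_cos ?in_itv /= ?lexx ?pi_ge0 ?w0 ?wp ?(ltW w0) ?(ltW wp).
have dA : is_derive (0 : R) 1 (acos \o F) (- (b * c)).
  have /andP[cw1 cw2] := cw.
  have dac : is_derive (F 0) 1 acos (- (sin w)^-1).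
    have -> : sin w = Num.sqrt (1 - cos w ^+ 2).
      by rewrite -sin_acos ?ltW// cosK// in_itv /= !ltW.
    by rewrite F0; exact: is_derive1_acos.
  have := is_derive1_comp dac dF.
  suff -> : - (sin w)^-1 * (sin w * b * c) = - (b * c) by [].
  by field; rewrite gt_eqF.
have H : is_derive (0 : R) 1 ((cst l + (acos \o F)) ^+ 2) (- (2 * (l + w) * b * c)).
  apply: is_derive_eq.
  rewrite add0r !fctE /= F0 cosK ?in_itv /= ?(ltW w0) ?(ltW wp)//.
  rewrite /GRing.scale /=; ring.
exact: H.
Qed.

(** * Polar coordinates on the sphere, comparison angles and hinge comparison *)

Lemma dot3E (R : realType) (u v : 'rV[R]_3) : dot3 u v =
  u 0 0 * v 0 0 + u 0 1 * v 0 1 + u 0 (inord 2) * v 0 (inord 2).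
Proof.
rewrite /dot3 mxE !big_ord_recl big_ord0 addr0 !mxE.
have -> : lift ord0 (lift ord0 ord0) = inord 2 :> 'I_3.
  by apply/val_inj; rewrite /= inordK.
have -> : lift ord0 ord0 = 1 :> 'I_3 by apply/val_inj.
by rewrite addrA.
Qed.

Definition row3 (R : realType) (a b c : R) : 'rV[R]_3 :=
  \row_(i < 3) nth 0 [:: a; b; c] i.

Lemma dot3_row3 (R : realType) (a b c a' b' c' : R) :
  dot3 (row3 a b c) (row3 a' b' c') = a * a' + b * b' + c * c'.
Proof. by rewrite dot3E !mxE /= inordK. Qed.

Lemma spherical_pointP (R : realType) (t ca sa : R) : ca ^+ 2 + sa ^+ 2 = 1 ->
  dot3 (row3 (cos t) (sin t * ca) (sin t * sa))
       (row3 (cos t) (sin t * ca) (sin t * sa)) == 1.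
Proof.
move=> h; rewrite dot3_row3; apply/eqP.
transitivity (cos t ^+ 2 + sin t ^+ 2 * (ca ^+ 2 + sa ^+ 2)); first by ring.
by rewrite h mulr1 cos2Dsin2.
Qed.

Lemma sphere2_dist_sym (R : realType) (u v : sphere2 R) :
  sphere2_dist u v = sphere2_dist v u.
Proof. by rewrite /sphere2_dist !dot3E; congr acos; ring. Qed.

(** Polar coordinates about the pole (1, 0, 0). The direction is given by cosine and sine instead of
    an angle, since a comparison triangle prescribes only the cosine. *)
Definition spherical_point (R : realType) (t ca sa : R)
    (h : ca ^+ 2 + sa ^+ 2 = 1) : sphere2 R :=
  exist (fun u => dot3 u u == 1) _ (spherical_pointP t h).

(** Law of cosines at the pole: [e] puts the second point in the direction (1, 0), so [ca] is the
    cosine of the angle between the two. *)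
Lemma sphere2_dist_spherical_point (R : realType) (s t ca sa : R)
    (h : ca ^+ 2 + sa ^+ 2 = 1) (e : 1 ^+ 2 + 0 ^+ 2 = 1 :> R) :
  sphere2_dist (spherical_point s h) (spherical_point t e) =
  acos (cos s * cos t + sin s * sin t * ca).
Proof. by rewrite /sphere2_dist /= dot3_row3; congr acos; ring. Qed.

(* Cosine of the angle, in a spherical triangle, between the sides of lengths u and
   b, opposite to the side of length D. *)
Definition comparison_cos (R : realType) (u b D : R) : R :=
  (cos D - cos u * cos b) / (sin u * sin b).

Lemma comparison_cosE (R : realType) (u b D : R) : 0 < u < pi -> 0 < b < pi ->
  cos u * cos b + sin u * sin b * comparison_cos u b D = cos D.
Proof.
move=> /sin_gt0_pi su /sin_gt0_pi sb; rewrite /comparison_cos; field.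
by rewrite !gt_eqF.
Qed.

(** As [cos] decreases on [0, pi], the triangle inequalities give
    [cos (u + b) <= cos D <= cos (u - b)]; the addition formulas turn this into the bound. *)
Lemma comparison_cos_bound (R : realType) (u b D : R) :
  0 < u < pi -> 0 < b < pi -> `|u - b| <= D -> D <= u + b -> u + b < pi ->
  `|comparison_cos u b D| <= 1.
Proof.
move=> up bp D1 D2 D3.
have su := sin_gt0_pi up; have sb := sin_gt0_pi bp.
have D0 : 0 <= D := le_trans (normr_ge0 _) D1.
have Dpi : D <= pi := le_trans D2 (ltW D3).
have lo : cos (u + b) <= cos D.
  by rewrite leNgt ltr_cos ?in_itv /= ?D0 ?Dpi ?(le_trans D0 D2) ?(ltW D3)// -leNgt.
have hi : cos D <= cos (u - b).
  have -> : cos (u - b) = cos `|u - b|.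
    by case: ger0P => _; rewrite ?cosN.
  by rewrite leNgt ltr_cos ?in_itv /= ?D0 ?Dpi ?normr_ge0 ?(le_trans D1)// -leNgt.
move: lo hi; rewrite cosD cosB => lo hi.
rewrite /comparison_cos ler_norml ler_pdivlMr ?ler_pdivrMr ?mulr_gt0//.
by apply/andP; split; lra.
Qed.

(** The comparison triangle is explicit: [p] goes to the pole, [y] to the direction (1, 0) and [q]
    to the direction given by the comparison cosine. The law of cosines then computes the model
    distance. *)
Lemma CAT1_hinge (R : realType) (X : metricType R) (p q y : X) (g : R -> X) :
  CAT1 X -> 0 < mdist p q -> 0 < mdist p y -> mdist p q + mdist p y < pi ->
  minimal_geodesic_between mdist p y g ->
  {in `[0, 1], forall t, mdist q (g t) <=
    acos (cos (mdist p q) * cos (t * mdist p y) + sin (mdist p q) *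
      sin (t * mdist p y) * comparison_cos (mdist p q) (mdist p y) (mdist q y))}.
Proof.
move=> [_ cat]; set u := mdist p q; set b := mdist p y; set D := mdist q y.
move=> u0 b0 ub gpy t t01.
have up : 0 < u < pi by lra.
have bp : 0 < b < pi by lra.
have tri1 : D <= u + b by rewrite /u metric_sym metric_triangle.
have tri2 : `|u - b| <= D.
  have := metric_triangle p y q; have := metric_triangle p q y.
  rewrite -/u -/b (metric_sym y q) -/D => *; rewrite ler_norml; lra.
have cD := comparison_cosE D up bp.
have := comparison_cos_bound up bp tri2 tri1 ub.
set c := comparison_cos _ _ _ in cD *; move=> c1.
(* The square root serves as the sine of the angle at the pole. *)
have hc : c ^+ 2 + Num.sqrt (1 - c ^+ 2) ^+ 2 = 1.
  rewrite sqr_sqrtr; first by rewrite addrC subrK.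
  by rewrite subr_ge0 -real_normK ?num_real// expr_le1.
have e : 1 ^+ 2 + 0 ^+ 2 = 1 :> R by ring.
pose gs (s : R) := spherical_point (s * b) e.
pose qs := spherical_point u hc.
have acos_cos (s : R) : 0 <= s <= pi -> acos (cos s) = s by move=> ?; rewrite cosK.
have gsd s s' : s \in `[0, 1] -> s' \in `[0, 1] ->
    sphere2_dist (gs s) (gs s') = `|s - s'| * b.
  rewrite !in_itv /= => /andP[s0 s1] /andP[s'0 s'1].
  rewrite sphere2_dist_spherical_point mulr1 -cosB -mulrBl.
  have -> : cos ((s - s') * b) = cos (`|s - s'| * b).
    by case: ger0P => _; rewrite ?mulNr ?cosN.
  rewrite acos_cos// mulr_ge0 ?(ltW b0)//=.
  have : `|s - s'| <= 1 by rewrite ler_norml; lra.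
  by nra.
rewrite -(sphere2_dist_spherical_point _ _ hc e).
apply: (cat q p y g qs (gs 0) (gs 1) gs) => //.
(* The perimeter is at most [2 * (u + b)]. *)
- rewrite (metric_sym q p) (metric_sym y q) -/u -/b -/D; lra.
- rewrite sphere2_dist_spherical_point mul0r cos0 sin0 mulr0 mul0r addr0 mulr1.
  by rewrite acos_cos ?(metric_sym q p)// -/u; lra.
- by rewrite gsd ?in_itv /= ?lexx ?ler01// sub0r normrN normr1 mul1r.
- have D0 : 0 <= D := mdist_ge0 _ _.
  rewrite sphere2_dist_sym sphere2_dist_spherical_point mul1r cD (metric_sym y q).
  by apply: acos_cos; lra.
- split=> // s s' s01 s'01.
  by rewrite !gsd ?in_itv /= ?lexx ?ler01// sub0r normrN normr1 mul1r.
Qed.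

(** * Exchange of the two sides in the first variation *)

(** No angle at [p] is defined: comparison angles of the triangles with vertices [p], [h s], [y]
    replace it. The terms [e] and [m] will come from minimality of [p] along [g], while [D] and [k]
    stand for [mdist x y ^+ 2] and [K / 2 * mdist p x ^+ 2]. *)
Lemma first_variation_sym (R : realType) (X : metricType R) (p x y : X)
    (g h : R -> X) (e m k D : R) :
  CAT1 X -> mdist p x + mdist p y < pi ->
  minimal_geodesic_between mdist p y g -> minimal_geodesic_between mdist p x h ->
  (forall t, 0 < t <= 1 ->
     mdist p x ^+ 2 <= mdist x (g t) ^+ 2 + t * e + t ^+ 2 * m) ->
  (forall s, 0 < s <= 1 ->
     mdist y (h s) ^+ 2 <= (1 - s) * mdist p y ^+ 2 + s * D - k * (1 - s) * s) ->
  mdist p y ^+ 2 <= D + e - k.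
Proof.
move=> cat ab gpy hpx He Hk.
have in01 (t : R) : 0 < t <= 1 -> t \in `[0, 1].
  by move=> /andP[t0 t1]; rewrite in_itv /= ltW.
have i0 : (0 : R) \in `[0, 1] by rewrite in_itv /= lexx ler01.
have i1 : (1 : R) \in `[0, 1] by rewrite in_itv /= lexx ler01.
have pg t : 0 < t <= 1 -> mdist p (g t) = t * mdist p y.
  move=> t01; case: gpy => gg g0 g1; rewrite -{1}g0 gg ?(in01 t)// g0 g1.
  by rewrite sub0r normrN ger0_norm//; lra.
have ph t : 0 < t <= 1 -> mdist p (h t) = t * mdist p x.
  move=> t01; case: hpx => gg g0 g1; rewrite -{1}g0 gg ?(in01 t)// g0 g1.
  by rewrite sub0r normrN ger0_norm//; lra.
have xh t : 0 < t <= 1 -> mdist x (h t) = (1 - t) * mdist p x.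
  move=> t01; case: hpx => gg g0 g1; rewrite -{1}g1 gg ?(in01 t)// g0 g1.
  by rewrite ger0_norm//; lra.
(* In the degenerate cases [p = x] and [p = y] one geodesic is constant, and [e] and
   [D - mdist p y ^+ 2 - k] are nonnegative separately. *)
have [xp|xp] := eqVneq p x.
  have e0 : 0 <= e.
    apply: (@affine_perturbation_ge0 _ _ (m + mdist p y ^+ 2)) => t t01.
    have := He t t01; rewrite -xp mdistxx pg//; lra.
  have : 0 <= D - mdist p y ^+ 2 - k.
    apply: (@affine_perturbation_ge0 _ _ k) => s s01.
    have := Hk s s01; have := ph s s01; rewrite -xp mdistxx mulr0.
    move=> /mdist_positivity <-; rewrite (metric_sym y p); lra.
  lra.
have [yp|yp] := eqVneq p y.
  have e0 : 0 <= e.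
    apply: (@affine_perturbation_ge0 _ _ m) => t t01.
    have := He t t01; have := pg t t01; rewrite -yp mdistxx mulr0.
    move=> /mdist_positivity <-; rewrite (metric_sym x p); lra.
  have : 0 <= D - k.
    apply: (@affine_perturbation_ge0 _ _ (k - mdist p x ^+ 2)) => s s01.
    have := Hk s s01; rewrite -yp mdistxx ph//; lra.
  rewrite -yp mdistxx; lra.
move: xp yp; rewrite -!mdist_gt0 => a0 b0.
set a := mdist p x in He Hk ab ph xh a0 *.
set b := mdist p y in He Hk ab pg b0 *.
pose c s := comparison_cos (s * a) b (mdist (h s) y).
have ab0 : 0 < 2 * a * b by rewrite !mulr_gt0.
(* Letting t -> 0 with s fixed bounds the comparison angle at p; letting s -> 0
   afterwards turns that bound into one on the derivative of d(y, h s)^2. *)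
have c_le s : 0 < s <= 1 -> 2 * a * b * c s <= e.
  move=> s01.
  have s0 : 0 < s by case/andP: s01.
  have s1 : s <= 1 by case/andP: s01.
  have sa0 : 0 < s * a by exact: mulr_gt0.
  have saa : s * a <= a by exact: (ler_piMl (ltW a0)).
  have sapi : 0 < s * a < pi by lra.
  (* The path from [x] to [g t] is broken at [h s], with [l = mdist x (h s)] and
     [w = mdist p (h s)]. Since [l + w = a], the slope depends on [s] only through [c s]. *)
  have der := is_derive_spherical_hinge_sqr (a - s * a) b (c s) sapi.
  pose f := fun t : R => (a - s * a + acos (cos (s * a) * cos (t * b)
     + sin (s * a) * sin (t * b) * c s)) ^+ 2.
  have der2 := is_deriveB (is_deriveD (is_deriveD (der : is_derive _ _ f _)
    (is_deriveZ e (is_derive_id (0 : R) 1)))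
    (is_deriveZ m (is_deriveX 2 (is_derive_id (0 : R) 1))))
    (is_derive_cst (a ^+ 2) (0 : R) 1).
  rewrite expr1 mulr0 scale0r scaler0 subr0 addr0 [_%:A]mulr1 in der2.
  have : 0 <= - (2 * (a - s * a + s * a) * b * c s) + e.
    apply: (is_derive_right_ge0 der2).
      rewrite !fctE /f /= !mul0r cos0 sin0.
      rewrite mulr1 mulr0 mul0r addr0 cosK ?in_itv /=; last lra.
      rewrite /GRing.scale /=; ring.
    near=> t; rewrite !fctE /=.
    have t01 : 0 < t <= 1.
      by apply/andP; split; near: t; [exact: nbhs_right_gt|exact: nbhs_right_le].
    have gt := @CAT1_hinge _ _ p (h s) y g cat; rewrite ph// in gt.
    have sab : s * a + b < pi by lra.
    have {}gt := gt sa0 b0 sab gpy t (in01 _ t01).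
    have tri := metric_triangle x (h s) (g t); rewrite xh// in tri.
    have := He t t01.
    have : mdist x (g t) ^+ 2 <= f t.
      rewrite /f ler_sqr ?nnegrE ?mdist_ge0 //; first by rewrite /c; lra.
      apply: le_trans (mdist_ge0 x (g t)) _; rewrite /c; lra.
    rewrite /GRing.scale /=; lra.
  lra.
have bp : 0 < b < pi by lra.
(* An upper bound for all [c s] that is free of [s], so that the function of [s] below has a
   computable slope. *)
pose ee := e / (2 * a * b).
have der := is_derive_spherical_hinge_sqr 0 a ee bp.
pose f := fun t : R =>
  (0 + acos (cos b * cos (t * a) + sin b * sin (t * a) * ee)) ^+ 2.
(* The right-hand side of [Hk] in powers of [s], minus the lower bound [f s] for
   [mdist y (h s) ^+ 2]. *)
have der2 := is_deriveB (is_deriveD (is_deriveD (is_derive_cst (b ^+ 2) (0 : R) 1)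
  (is_deriveZ (D - k - b ^+ 2) (is_derive_id (0 : R) 1)))
  (is_deriveZ k (is_deriveX 2 (is_derive_id (0 : R) 1)))) (der : is_derive _ _ f _).
rewrite expr1 mulr0 scale0r scaler0 addr0 add0r opprK [_%:A]mulr1 in der2.
(* Nothing keeps [ee] below 1, so the argument of [acos] is bounded through its limit [cos b < 1];
   its lower bound -1 will come from [dM]. *)
have Mlt1 : \forall s \near (0 : R)^'+,
    cos b * cos (s * a) + sin b * sin (s * a) * ee < 1.
  have cvM : cos b * cos (s * a) + sin b * sin (s * a) * ee @[s --> (0 : R)^'+]
      --> cos b * cos (0 * a) + sin b * sin (0 * a) * ee.
    apply: cvg_at_right_filter.
    have cva : (s : R) * a @[s --> (0 : R)] --> 0 * a by apply: cvgMl; exact: cvg_id.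
    have cvcos : cos (s * a) @[s --> (0 : R)] --> cos (0 * a).
      by apply: continuous_cvg cva; exact: continuous_cos.
    have cvsin : sin (s * a) @[s --> (0 : R)] --> sin (0 * a).
      by apply: continuous_cvg cva; exact: continuous_sin.
    apply: cvgD; first by apply: cvgM => //; exact: cvg_cst.
    by apply: cvgM; [apply: cvgM => //|]; exact: cvg_cst.
  apply: (cvgr_lt _ cvM).
  rewrite mul0r cos0 sin0 mulr0 mul0r addr0 mulr1 -(@cos0 R).
  by rewrite ltr_cos ?in_itv /= ?lexx ?pi_ge0 //; lra.
have : 0 <= (D - k - b ^+ 2) + 2 * (0 + b) * a * ee.
  apply: (is_derive_right_ge0 der2).
    rewrite !fctE /f /= !mul0r cos0 sin0.
    rewrite mulr1 mulr0 mul0r addr0 add0r cosK ?in_itv /=; last lra.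
    rewrite /GRing.scale /=; ring.
  near=> s; rewrite !fctE /=.
  have s01 : 0 < s <= 1.
    by apply/andP; split; near: s; [exact: nbhs_right_gt|exact: nbhs_right_le].
  have s0 : 0 < s by case/andP: s01.
  have s1 : s <= 1 by case/andP: s01.
  have sa0 : 0 < s * a by exact: mulr_gt0.
  have saa : s * a <= a by exact: (ler_piMl (ltW a0)).
  have sapi : 0 < s * a < pi by lra.
  have := c_le s s01; rewrite mulrC -ler_pdivlMr// -/ee => cee.
  have cE := comparison_cosE (mdist (h s) y) sapi bp.
  rewrite -/(c s) in cE.
  have dpos : 0 <= mdist (h s) y by exact: mdist_ge0.
  have dle : mdist (h s) y <= pi.
    have := metric_triangle (h s) p y; rewrite (metric_sym (h s) p) ph// -/b; lra.
  pose M := cos b * cos (s * a) + sin b * sin (s * a) * ee.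
  have M1 : M < 1 by rewrite /M; near: s; exact: Mlt1.
  have dM : cos (mdist (h s) y) <= M.
    rewrite -cE /M; have := sin_gt0_pi sapi; have := sin_gt0_pi bp; move=> sb ssa.
    have := ler_wpM2l (ltW (mulr_gt0 sb ssa)) cee; lra.
  have M11 : -1 <= M <= 1 by rewrite (le_trans (cos_geN1 _) dM) ltW.
  have aM : acos M <= mdist (h s) y.
    rewrite leNgt; apply/negP => lt.
    have := lt; rewrite -ltr_cos ?in_itv /= ?acos_ge0 ?acos_lepi ?dpos ?dle//.
    by rewrite acosK ?in_itv //= ltNge dM.
  have := Hk s s01; rewrite metric_sym.
  have : f s <= mdist (h s) y ^+ 2.
    by rewrite /f add0r -/M ler_sqr ?nnegrE ?acos_ge0.
  rewrite /GRing.scale /=; lra.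
rewrite add0r (_ : 2 * b * a * ee = e); first by lra.
by rewrite /ee; field; rewrite !gt_eqF.
Unshelve. all: by end_near. Qed.

(** * Minimality of the resolvent point and the two estimates *)

Lemma resolvent_le (R : realType) (X : metricType R) (phi : X -> \bar R) (tau : R)
    (x p z : X) : resolvent phi tau x p ->
  (phi p + (mdist x p ^+ 2 / (2 * tau))%:E <=
   phi z + (mdist x z ^+ 2 / (2 * tau))%:E)%E.
Proof. by move=> ->; apply: ereal_inf_lbound; exists z. Qed.

(** Minimality is tested against [g t] on the geodesic supplied by convexity. Splitting
    [(1 - t) * t] into orders of [t] gives the form that [first_variation_sym] takes. *)
Lemma lambda_convex_resolvent_le (R : realType) (X : metricType R)
    (phi : X -> \bar R) (lambda tau fp fy : R) (x p y : X) :
  lambda_convex lambda phi -> 0 < tau -> resolvent phi tau x p ->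
  phi p = fp%:E -> phi y = fy%:E ->
  exists2 g, minimal_geodesic_between mdist p y g &
  forall t, 0 < t <= 1 ->
    mdist x p ^+ 2 <= mdist x (g t) ^+ 2
      + t * (2 * tau * (fy - fp) - lambda * tau * mdist p y ^+ 2)
      + t ^+ 2 * (lambda * tau * mdist p y ^+ 2).
Proof.
move=> cvx tau0 res pp py.
have [||g gpy gcvx] := cvx p y; rewrite /effective_domain /= ?pp ?py//.
exists g => // t t01.
have t01' : t \in `[0, 1] by rewrite in_itv /= ltW; case/andP: t01.
have := le_trans (resolvent_le (g t) res) (leeD2r _ (gcvx t t01')).
rewrite pp py -!EFinM -!EFinD lee_fin => le.
have {le} := ler_wpM2r (ltW tau0) le.
have tau_neq0 : tau != 0 by rewrite gt_eqF.
have E (u v : R) : (u + v / (2 * tau)) * tau = u * tau + v / 2 by field.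
rewrite !E; lra.
Qed.

Theorem lemma3p1 (R : realType) (X : metricType R)
    (phi : X -> \bar R) (lambda : R) (tau_star : \bar R)
    (x : X) (C tau : R) (x_tau : X) (r : R) (y : X) (K : R) :
  complete_space X ->
  CAT1 X ->
  (forall z, (-oo < phi z)%E) ->
  lower_semicontinuous phi ->
  effective_domain phi !=set0 ->
  lambda_convex lambda phi ->
  coercive phi tau_star ->
  effective_domain phi x ->
  apriori_constant phi x tau_star (phi x) (tau_star * 8^-1%:E)%E C ->
  0 < tau ->
  (tau%:E < Order.min (pi ^+ 2 / (2 * C))%:E (tau_star * 8^-1%:E))%E ->
  resolvent phi tau x x_tau ->
  r < pi ->
  effective_domain phi y ->
  ball x_tau (r - mdist x x_tau) y ->
  sqdist_convexity_constant X r K ->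
  ((mdist x_tau y ^+ 2)%:E
    <= (mdist x y ^+ 2)%:E - (lambda * tau * mdist x_tau y ^+ 2)%:E
       + (2 * tau)%:E * (phi y - phi x_tau)
       - (K / 2 * mdist x x_tau ^+ 2)%:E)%E
  /\
  ((mdist x y ^+ 2)%:E - (lambda * tau * mdist x_tau y ^+ 2)%:E
       + (2 * tau)%:E * (phi y - phi x_tau)
       - (K / 2 * mdist x x_tau ^+ 2)%:E
    <= (mdist x y ^+ 2)%:E - (lambda * tau * mdist x_tau y ^+ 2)%:E
       + (2 * tau)%:E * (phi y - phi x_tau)
       + (Num.max 0 (- K) * tau)%:E * (phi x - phi x_tau))%E.
Proof.
move=> _ cat phiNy _ _ cvx _ xD _ tau0 _ res rpi yD yball Kcvx.
have fin z : effective_domain phi z -> phi z = (fine (phi z))%:E.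
  move=> zD; rewrite fineK// fin_numE gt_eqF// /=; exact/eqP.
have resx := resolvent_le x res.
have px := fin _ xD; have py := fin _ yD.
(* Minimality tested at [x], where [phi] is finite, excludes the value [+oo]. *)
have pD : effective_domain phi x_tau.
  by move=> pp; move: resx; rewrite /= in pp; rewrite pp px addye// -EFinD leye_eq.
have pp := fin _ pD.
move: (fine (phi x)) (fine (phi y)) (fine (phi x_tau)) px py pp => fx fy fp px py pp.
(* Minimality tested at [x] again; with [- K <= Num.max 0 (- K)] this yields the second
   inequality. *)
have xpx : mdist x x_tau ^+ 2 <= 2 * tau * (fx - fp).
  move: resx; rewrite pp px -!EFinD lee_fin mdistxx expr0n mul0r addr0.
  by rewrite -lerBrDl ler_pdivrMr ?mulr_gt0// mulrC.
rewrite px py pp -!EFinB -!EFinM -!EFinD !lee_fin; split; last first.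
  rewrite lerD2l.
  have dge : 0 <= mdist x x_tau ^+ 2 by exact: sqr_ge0.
  have m0 : 0 <= Num.max 0 (- K) by rewrite le_max lexx.
  have mK : - K <= Num.max 0 (- K) by rewrite le_max lexx orbT.
  have := ler_wpM2l m0 xpx; have := ler_wpM2r dge mK; lra.
have [g gpy gE] := lambda_convex_resolvent_le cvx tau0 res pp py.
have [h hpx] := cat.1 x_tau x.
rewrite ballEmdist /= in yball.
have dpx := mdist_ge0 x_tau x.
have := @first_variation_sym _ _ x_tau x y g h
  (2 * tau * (fy - fp) - lambda * tau * mdist x_tau y ^+ 2)
  (lambda * tau * mdist x_tau y ^+ 2)
  (K / 2 * mdist x_tau x ^+ 2) (mdist x y ^+ 2) cat.
rewrite !(metric_sym x_tau x) => fv.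
rewrite (metric_sym x_tau x) in dpx.
have {}fv := fv _ gpy hpx gE _; apply: le_trans (fv _ _) _; last by lra.
- lra.
- move=> s s01; case: hpx => gh h0 h1.
  (* Convexity is used with centre [y] along the geodesic from [x_tau] to [x]; the radius
     [r - mdist x x_tau] keeps that geodesic in [ball y r]. *)
  have hball : {in `[0, 1], forall t, ball y r (h t)}.
    move=> t t01; rewrite ballEmdist /=.
    have i0 : (0 : R) \in `[0, 1] by rewrite in_itv /= lexx ler01.
    have := gh 0 t i0 t01; rewrite h0 h1 sub0r normrN => ht.
    have := metric_triangle y x_tau (h t).
    rewrite ht (metric_sym y x_tau) (metric_sym x_tau x).
    move: t01; rewrite in_itv /= => /andP[t0 t1]; rewrite ger0_norm//.
    have := ler_piMl dpx t1; lra.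
  have s01' : s \in `[0, 1] by rewrite in_itv /= ltW; case/andP: s01.
  have := Kcvx y h gh hball s s01'; rewrite h0 h1 !(metric_sym y) (metric_sym x_tau x).
  lra.
Qed.
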